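(* Let $g:U\times X\to X$ be a compactly driven system. Then there exists a universal semi-conjugacy $h:\overleftarrow{U}\to X_U$ of $g$ if and only if $g$ has the unique solution property (USP). Further, in this case $h=\mathit{i}^{-1}\circ\mathcal{E}$, where $\mathcal{E}$ is the encoding map and $\mathit{i}:x\mapsto\{x\}$. On the other hand, suppose $h:\overleftarrow{U}\to X_U$ is a surjective function, not assumed to be continuous, such that $g_v\circ h=h\circ\sigma_v$ for all $v\in U$; then $h$ is not continuous when $g$ does not have the USP.
   Context: A driven system consists of a metric space $(U,d_U)$, a compact metric space $(X,d)$ and a continuous map $g:U\times X\to X$. It is a compactly driven system if in addition $U$ is compact. Write $g_u(x):=g(u,x)$. Let $\overline{U}:=\prod_{i\in\mathbb{Z}}U$ and $\overleftarrow{U}:=\prod_{i=-\infty}^{-1}U$, with product topologies; elements of $\overleftarrow{U}$ are written $\overleftarrow{u}=(\ldots,u_{-2},u_{-1})$. A solution for input $\bar u=\{u_n\}\in\overline{U}$ is a sequence $\{x_n\}_{n\in\mathbb{Z}}$ in $X$ with $x_{n+1}=g(u_n,x_n)$ for all $n\in\mathbb{Z}$. The system $g$ has the unique solution property (USP) if for each $\bar u\in\overline{U}$ there is exactly one solution. The reachable set $X_U\subset X$ is the set of all $x\in X$ such that $x=x_k$ for some $k\in\mathbb{Z}$ and some solution $\{x_n\}$ for some $\bar u\in\overline{U}$; it carries the subspace topology and $g_v(X_U)\subset X_U$ for all $v\in U$. For $v\in U$, $\sigma_v:\overleftarrow{U}\to\overleftarrow{U}$ is $\sigma_v(\ldots,u_{-2},u_{-1})=(\ldots,u_{-2},u_{-1},v)$.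 A universal semi-conjugacy of $g$ is a continuous surjective map $h:\overleftarrow{U}\to X_U$ with $g_v\circ h=h\circ\sigma_v$ for all $v\in U$. The encoding map is $\mathcal{E}(\overleftarrow{u}):=\bigcap_{n\ge1}g_{u_{-1}}\circ\cdots\circ g_{u_{-n}}(X)$, a nonempty closed subset of $X$. The system $g$ has the USP if and only if $\mathcal{E}(\overleftarrow{u})$ is a singleton for every $\overleftarrow{u}\in\overleftarrow{U}$, in which case $\mathit{i}^{-1}\circ\mathcal{E}$ sends $\overleftarrow{u}$ to the unique element of $\mathcal{E}(\overleftarrow{u})$. *)

(* Defs.v *)
From HB Require Import structures.
From mathcomp Require Import all_boot all_order all_algebra.
From mathcomp Require Import all_classical all_reals all_analysis.

Set Implicit Arguments.
Unset Strict Implicit.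
Unset Printing Implicit Defensive.

Local Open Scope classical_set_scope.
Local Open Scope ring_scope.

Definition driven_system (R : realType) (U X : metricType R) (g : U * X -> X) :
  Prop := compact [set: X] /\ continuous g.

Definition compactly_driven_system (R : realType) (U X : metricType R)
  (g : U * X -> X) : Prop := driven_system g /\ compact [set: U].

(* Left-infinite sequences (..., u_{-2}, u_{-1}) are indexed by nat, reading
   backwards: the value at k is u_{-(k+1)}. *)
Definition left_seq (R : realType) (U : metricType R) := {ptws nat -> U}.

(* (..., u_{-2}, u_{-1}) |-> (..., u_{-2}, u_{-1}, v) *)
Definition shift_in (R : realType) (U : metricType R) (v : U)
  (u : left_seq U) : left_seq U := fun k => if k is k'.+1 then u k' else v.

Section DrivenSystem.
Context {R : realType} {U X : metricType R}.
Variable g : U * X -> X.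

Definition is_solution (u : int -> U) (x : int -> X) : Prop :=
  forall n : int, x (n + 1) = g (u n, x n).

Definition USP : Prop := forall u : int -> U, exists! x, is_solution u x.

Definition reachable : set X :=
  [set y | exists u x, is_solution u x /\ exists k : int, y = x k].

(* past_map u n = g_{u_{-1}} \o ... \o g_{u_{-n}} *)
Fixpoint past_map (u : left_seq U) (n : nat) : X -> X :=
  if n is n'.+1 then fun x => past_map u n' (g (u n', x)) else id.

Definition encoding (u : left_seq U) : set X :=
  \bigcap_(n in [set n | (1 <= n)%N]) (past_map u n @` [set: X]).

(* Below, [set_type reachable] carries the library's subspace topology, i.e.
   the initial topology of the inclusion [set_val] into X. *)
Definition intertwines (h : left_seq U -> set_type reachable) : Prop :=
  forall (v : U) (u : left_seq U),
    g (v, set_val (h u)) = set_val (h (shift_in v u)).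

Definition universal_semiconjugacy (h : left_seq U -> set_type reachable) :
  Prop :=
  [/\ continuous h, set_surj [set: left_seq U] [set: set_type reachable] h
    & intertwines h].

End DrivenSystem.

Definition singleton_map (T : Type) (x : T) : set T := [set x].

(* f = i^-1 \o E, where i is the injection x |-> {x} and i^-1 is defined only on
   the image of i: every E a is a singleton, with f a as its element. *)
Definition eq_singleton_inv_comp (A T : Type) (f : A -> T) (E : A -> set T) :
  Prop := singleton_map (T := T) \o f = E.

(* Main.v *)
Require Import Defs.
From HB Require Import structures.
From mathcomp Require Import all_boot all_order all_algebra.
From mathcomp Require Import all_classical all_reals all_analysis.
Import GRing.Theory.

(** The bridge between solutions and the encoding map is the notion of a
    backward orbit of a left-infinite input u: a sequence x with
    x n = g (u n, x n.+1). The past of a solution is a backward orbit, and a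
    backward orbit extends to a solution by running the system forward under an
    arbitrary future input (orbit_solution); so every point of a backward orbit
    is reachable. The encoding of u is exactly the set of endpoints x 0 of its
    backward orbits: one inclusion is immediate, the other (encoding_orbit)
    pulls a point of the encoding back one step at a time, each step being an
    intersection of nested nonempty compact sets.

    From a semi-conjugacy to unique solutions (semiconjugacy_orbit). Let x be a
    backward orbit of u. Since x n is reachable and h is onto, x n = h (w n) for
    some input w n, which may have nothing to do with u. Pushing forward with
    the last n values of u and using the intertwining relation n times,
    x 0 = h (w n followed by u_{-n}, ..., u_{-1}). These inputs converge to u
    coordinatewise, so continuity of h forces x 0 = h u. Hence every solution
    is read off from h, which gives uniqueness; existence holds because the
    values of h along the successive pasts of an input form a solution. The
    same identity says that the encoding of u is the singleton of h u. The
    statement on discontinuous h is the contrapositive.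

    From unique solutions to a semi-conjugacy (USP_semiconjugacy). Under the
    USP every encoding is a singleton, and h u is its element. The intertwining
    relation and surjectivity are then formal. Continuity is the upper
    semicontinuity of the encoding (past_range_near): if the encoding of u lies
    in an open set V, then by compactness already some finite stage
    g_{u_{-1}} o ... o g_{u_{-n}} (X) lies in V, and by the tube lemma this
    persists for all inputs near u. *)

Local Open Scope classical_set_scope.
Local Open Scope ring_scope.

Set Implicit Arguments.
Unset Strict Implicit.
Unset Printing Implicit Defensive.

(** * Compact spaces and products *)

(** Cantor's intersection theorem. Were the intersection empty, each point would
    have a neighbourhood missing K n for all large n, so by compactness a single
    K n would be missed by the whole space. *)
Lemma compact_nested_bigcap (T : topologicalType) (K : nat -> set T) :
  compact [set: T] -> (forall n, closed (K n)) ->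
  (forall n, K n.+1 `<=` K n) -> (forall n, K n !=set0) ->
  exists z, forall n, K n z.
Proof.
move=> /compact_near_coveringP cT clK decK K0.
have {}decK m n : (m <= n)%N -> K n `<=` K m.
  elim: n => [|n IHn]; first by rewrite leqn0 => /eqP ->.
  rewrite leq_eqVlt => /predU1P[->//|]; rewrite ltnS => /IHn.
  exact: subset_trans (decK n).
apply: contrapT => /forallNP noz.
have /cT : forall x : T, setT x -> \forall x' \near x & n \near \oo, ~ K n x'.
  move=> x _; have /existsNP[m nKmx] := noz x.
  exists (~` K m, [set n | (m <= n)%N]) => /=; last first.
    by move=> [y n] /= [nKmy mn] /(decK _ _ mn).
  split; last exact: nbhs_infty_ge.
  by apply: open_nbhs_nbhs; split => //; exact: closed_openC.
move=> [N _ /(_ N (leqnn N)) nKN].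
by have [z /(nKN z I)] := K0 N.
Qed.

Lemma pair_continuous (S T : topologicalType) (a : S) :
  continuous (pair a : T -> S * T).
Proof. by move=> x; apply: cvg_pair; [exact: cvg_cst|exact: cvg_id]. Qed.

(** * Input sequences *)

Section InputSequences.
Context {R : realType} {U : metricType R}.
Implicit Types (u w : left_seq U) (b : int -> U).

Definition drop_last u : left_seq U := fun n => u n.+1.

(** The input w followed by u_{-n}, ..., u_{-1}, written as n successive shifts
    so that it unfolds in step with past_map. *)
Fixpoint splice u n w : left_seq U :=
  if n is n'.+1 then splice u n' (shift_in (u n') w) else w.

Lemma splice_ge u n w i : splice u n w (n + i)%N = w i.
Proof. by elim: n w i => //= n IHn w i; rewrite addSnnS IHn. Qed.

Lemma splice_lt u n w i : (i < n)%N -> splice u n w i = u i.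
Proof.
elim: n w => //= n IHn w; rewrite ltnS leq_eqVlt => /predU1P[->|/IHn//].
by rewrite -[X in splice _ _ _ X]addn0 splice_ge.
Qed.

Lemma left_seq_cvg (f : nat -> left_seq U) u :
  (forall i, f n i @[n --> \oo] --> u i) -> f n @[n --> \oo] --> u.
Proof. by move=> fu; apply/pointwise_cvgP. Qed.

(** The inputs w are arbitrary, because convergence in the product topology is
    coordinatewise and each coordinate is eventually that of u. *)
Lemma splice_cvg u (w : nat -> left_seq U) :
  splice u n (w n) @[n --> \oo] --> u.
Proof.
apply: left_seq_cvg => i; apply: cvg_near_cst.
by near=> n; apply: splice_lt; near: n; exact: nbhs_infty_gt.
Unshelve. all: by end_near. Qed.

Definition past_input b (k : int) : left_seq U := fun i => b (k - i.+1%:Z).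

(** Any future would do; u_{-1} is a point of U that is at hand. *)
Definition extend_input u (k : int) : U := if k is Negz m then u m else u 0%N.

Lemma past_inputS b k : past_input b (k + 1) = shift_in (b k) (past_input b k).
Proof.
apply/funext => -[|i] /=; rewrite /past_input; first by rewrite addrK.
by rewrite (intS i.+1) opprD addrA addrK.
Qed.

Lemma past_extend_input u : past_input (extend_input u) 0 = u.
Proof. by apply/funext => i; rewrite /past_input sub0r -NegzE. Qed.

End InputSequences.

(** * Backward orbits and the encoding *)

Section Orbits.
Context {R : realType} {U X : metricType R}.
Variable g : U * X -> X.
Implicit Types (u w : left_seq U) (b : int -> U).

Definition backward_orbit u (x : nat -> X) : Prop :=
  forall n, x n = g (u n, x n.+1).

Lemma past_map_orbit u x n : backward_orbit u x -> past_map g u n (x n) = x 0%N.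
Proof. by move=> ux; elim: n => //= n; rewrite -ux. Qed.

(** The definition of past_map peels off the oldest input; pulling back a point
    of the encoding by one step requires peeling off the most recent one. *)
Lemma past_mapS_outer u n x :
  past_map g u n.+1 x = g (u 0%N, past_map g (drop_last u) n x).
Proof. by elim: n x => //= n IHn x; rewrite -IHn. Qed.

Lemma solution_orbit b (x : int -> X) k : is_solution g b x ->
  backward_orbit (past_input b k) (fun n => x (k - n%:Z)).
Proof.
move=> bx n; rewrite /past_input -bx; congr x.
by rewrite intS [1 + _]addrC opprD addrA subrK.
Qed.

(** Lets the USP, which speaks of bi-infinite sequences, be applied to backward
    orbits. *)
Lemma orbit_solution u x : backward_orbit u x ->
  exists2 y, is_solution g (extend_input u) y & forall n, y (- n%:Z) = x n.
Proof.
move=> ux.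
exists (fun k : int => match k with
  | Negz m => x m.+1 | Posz n => iter n (fun z => g (u 0%N, z)) (x 0%N) end).
  move=> [n|[|n]] /=.
  - by rewrite addn1.
  - by rewrite ux.
  - by rewrite subn1 ux.
by case=> [|n]; rewrite ?oppr0 // -NegzE.
Qed.

Lemma orbit_reachable u x n : backward_orbit u x -> reachable g (x n).
Proof.
move=> /orbit_solution[y y_sol yx].
by exists (extend_input u), y; split => //; exists (- n%:Z).
Qed.

(** Adding the stage n = 0, which is the whole space, does not change the
    intersection and makes it start at the base case of past_map. *)
Lemma encodingP u y :
  encoding g u y <-> forall n, exists x, past_map g u n x = y.
Proof.
split=> [uy [|n]|uy n _]; first by exists y.
  by have [x _ <-] := uy n.+1 isT; exists x.
by have [x <-] := uy n; exists x.
Qed.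

Lemma orbit_encoding u x : backward_orbit u x -> encoding g u (x 0%N).
Proof.
by move=> ux; apply/encodingP => n; exists (x n); exact: past_map_orbit.
Qed.

Lemma encoding_shift_in v u y :
  encoding g u y -> encoding g (shift_in v u) (g (v, y)).
Proof.
move=> /encodingP uy; apply/encodingP => -[|n]; first by exists (g (v, y)).
by have [x <-] := uy n; exists x; rewrite past_mapS_outer.
Qed.

Section Compact.
Hypotheses (cX : compact [set: X]) (cg : continuous g).

(** Joint continuity in the input and the point, as the tube lemma needs. *)
Lemma past_map_continuous n :
  continuous (fun p : left_seq U * X => past_map g p.1 n p.2).
Proof.
elim: n => [|n IHn] p /=; first exact: cvg_snd.
have cn : (q.1 n @[q --> p] --> p.1 n).
  apply: (@cvg_comp _ _ _ fst (fun u : left_seq U => u n)).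
    exact: cvg_fst.
  exact: (@proj_continuous nat (fun=> U) n).
have cgn : (g (q.1 n, q.2) @[q --> p] --> g (p.1 n, p.2)).
  have c2 : (q.2 @[q --> p] --> p.2) by exact: cvg_snd.
  apply: (continuous2_cvg (h := fun v x => g (v, x)) _ _ cn c2).
  by move=> /=; rewrite (_ : (fun=> _) = g); [exact: cg|apply/funext => -[]].
have c1 : (q.1 @[q --> p] --> p.1) by exact: cvg_fst.
have := continuous2_cvg (h := fun u x => past_map g u n x) _
  (IHn (p.1, g (p.1 n, p.2))) c1 cgn.
exact.
Qed.

Lemma closed_past_range u n : closed (range (past_map g u n)).
Proof.
apply: compact_closed; first exact: metric_hausdorff.
apply: continuous_compact => //; apply: continuous_subspaceT => x.
apply: (@continuous_comp _ _ _ (pair u)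
  (fun p : left_seq U * X => past_map g p.1 n p.2)).
  exact: pair_continuous.
exact: past_map_continuous.
Qed.

Lemma past_range_decreasing u n :
  range (past_map g u n.+1) `<=` range (past_map g u n).
Proof. by move=> _ [x _ <-] /=; exists (g (u n, x)). Qed.

(** One step of the construction of a backward orbit. The sets of candidates z
    lying in the n-th stage for the shortened input are compact, nested and
    nonempty, so a single z serves all n. *)
Lemma encoding_pred u y : encoding g u y ->
  exists2 z, g (u 0%N, z) = y & encoding g (drop_last u) z.
Proof.
move=> /encodingP uy.
pose K n := [set z | g (u 0%N, z) = y] `&` range (past_map g (drop_last u) n).
have [||||z Kz] := @compact_nested_bigcap X K.
- exact: cX.
- move=> n; apply: closedI; last exact: closed_past_range.
  rewrite (_ : [set _ | _] = (g \o pair (u 0%N)) @^-1` [set y]) //.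
  apply: preimage_closed.
    move=> z _; apply: continuous_comp; [exact: pair_continuous|exact: cg].
  exact/accessible_closed_set1/hausdorff_accessible/metric_hausdorff.
- by move=> n; apply: setIS; exact: past_range_decreasing.
- move=> n; have [x uxy] := uy n.+1.
  exists (past_map g (drop_last u) n x); split; last by exists x.
  by rewrite /= -past_mapS_outer.
exists z; first by have [] := Kz 0%N.
by apply/encodingP => n; have [_ [x _ <-]] := Kz n; exists x.
Qed.

Lemma encoding_orbit u y : encoding g u y ->
  exists2 x, backward_orbit u x & x 0%N = y.
Proof.
move=> uy.
(* The states of the dependent choice carry the remaining input, so that the
   step relation does not depend on time. *)
pose T := {p : left_seq U * X | encoding g p.1 p.2}.
pose step (p q : T) := (sval q).1 = drop_last (sval p).1 /\
  g ((sval p).1 0%N, (sval q).2) = (sval p).2.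
have next (p : T) : {q | step p q}.
  case: p => -[w z] /= wz; apply/cid.
  have [z' gz' wz'] := encoding_pred wz.
  by exists (exist _ (drop_last w, z') wz').
have [f [f0 fS]] := dependent_choice next (exist _ (u, y) uy).
have f1 n i : (sval (f n)).1 i = u (n + i)%N.
  elim: n i => [|n IHn] i; first by rewrite f0.
  by have [-> _] := fS n; rewrite /drop_last IHn addSnnS.
exists (fun n => (sval (f n)).2); last by rewrite f0.
by move=> n; have [_ <-] := fS n; rewrite f1 addn0.
Qed.

(** Upper semicontinuity of the encoding. The first half finds a finite stage in
    V, as otherwise the stages minus V would be nested, nonempty and compact,
    with a common point in the encoding but not in V; the second half is the
    tube lemma. *)
Lemma past_range_near u (V : set X) : open V ->
  (forall y, encoding g u y -> V y) ->
  exists n, \forall w \near u, range (past_map g w n) `<=` V.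
Proof.
move=> oV uV.
have [n nV] : exists n, range (past_map g u n) `<=` V.
  apply: contrapT => /forallNP nV.
  have [||||z Kz] := @compact_nested_bigcap X
      (fun n => range (past_map g u n) `&` ~` V).
  - exact: cX.
  - by move=> n; apply: closedI (open_closedC oV); exact: closed_past_range.
  - by move=> n; apply: setSI; exact: past_range_decreasing.
  - by move=> n; have /existsNP[y /not_implyP[? ?]] := nV n; exists y.
  have [_] := Kz 0%N; apply; apply: uV.
  by apply/encodingP => n; have [[x _ <-] _] := Kz n; exists x.
exists n; move/compact_near_coveringP : cX => cvX.
have := cvX _ (nbhs u) (fun w x => V (past_map g w n x)) _.
have /[swap]/[apply] : forall x : X, setT x ->
    \forall x' \near x & w \near u, V (past_map g w n x').
  move=> x _.
  have : nbhs (u, x) [set p : left_seq U * X | V (past_map g p.1 n p.2)].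
    apply: past_map_continuous; apply: open_nbhs_nbhs; split => //.
    by apply: nV; exists x.
  move=> [[A B] [/= uA xB] AB]; exists (B, A) => //= -[x' w] /= [Bx' Aw].
  exact: (AB (w, x')).
by apply: filterS => w wV _ [x _ <-]; exact: wV.
Qed.

End Compact.

(** * From a semi-conjugacy to unique solutions *)

Section SemiConjugacy.
Variable h : left_seq U -> set_type (reachable g).
Hypothesis hg : intertwines h.

Lemma past_map_semiconjugacy u n w :
  past_map g u n (set_val (h w)) = set_val (h (splice u n w)).
Proof. by elim: n w => //= n IHn w; rewrite hg IHn. Qed.

Hypotheses (hc : continuous h)
  (hs : set_surj [set: left_seq U] [set: set_type (reachable g)] h).

(** The point x n may be encoded by any input w n, but after n steps of u the
    encoding inputs agree with u back to time -n, hence converge to u, while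
    their image under h is constantly x 0. *)
Lemma semiconjugacy_orbit u x : backward_orbit u x -> set_val (h u) = x 0%N.
Proof.
move=> ux.
have /choice[w wx] : forall n, exists w, set_val (h w) = x n.
  move=> n.
  have [w _ hw] := hs (t := SigSub (mem_set (orbit_reachable n ux))) I.
  by exists w; rewrite hw.
pose H := set_val \o h.
have Hc : continuous H.
  by move=> v; apply: continuous_comp; [exact: hc|exact: initial_continuous].
have H_splice n : H (splice u n (w n)) = x 0%N.
  by rewrite /H /= -past_map_semiconjugacy wx past_map_orbit.
have : H (splice u n (w n)) @[n --> \oo] --> H u.
  exact: (cvg_comp _ _ (splice_cvg w) (Hc u)).
rewrite (_ : (fun n => _) = fun=> x 0%N); last exact/funext.
move=> /cvg_unique; apply; first exact: metric_hausdorff.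
exact: cvg_cst.
Qed.

Lemma semiconjugacy_USP : USP g.
Proof.
move=> b; exists (fun k => set_val (h (past_input b k))); split.
  by move=> k; rewrite past_inputS hg.
move=> x bx; apply/funext => k.
by rewrite (semiconjugacy_orbit (solution_orbit k bx)) subr0.
Qed.

End SemiConjugacy.

(** * From unique solutions to a semi-conjugacy *)

Section UniqueSolution.
Hypotheses (cX : compact [set: X]) (cg : continuous g) (uspg : USP g).

Lemma USP_orbit u : exists x, backward_orbit u x.
Proof.
have [x [ux _]] := uspg (extend_input u).
by have := solution_orbit 0 ux; rewrite past_extend_input; eexists; eassumption.
Qed.

Lemma USP_encoding_unique u y z : encoding g u y -> encoding g u z -> y = z.
Proof.
move=> /(encoding_orbit cX cg)[x ux <-] /(encoding_orbit cX cg)[x' ux' <-].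
have [s s_sol sx] := orbit_solution ux.
have [s' s'_sol s'x'] := orbit_solution ux'.
have [t [_ t_uniq]] := uspg (extend_input u).
by rewrite -sx -s'x' -(t_uniq _ s_sol) -(t_uniq _ s'_sol).
Qed.

Lemma USP_semiconjugacy :
  exists h : left_seq U -> set_type (reachable g), universal_semiconjugacy h.
Proof.
have /choice[h hE] : forall u : left_seq U,
    exists y : set_type (reachable g), encoding g u (set_val y).
  move=> u; have [x ux] := USP_orbit u.
  by exists (SigSub (mem_set (orbit_reachable 0 ux))); exact: orbit_encoding.
exists h; split.
- move=> u; apply: continuous_comp_initial => {}u.
  move=> A /=; rewrite nbhsE => -[V [oV Vu] VA].
  have [|n nV] := @past_range_near cX cg u V oV.
    by move=> y uy; rewrite (USP_encoding_unique uy (hE u)).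
  apply: filterS nV => w wV; apply/VA/wV.
  by have /encodingP/(_ n)[x hx] := hE w; exists x.
- move=> y _.
  have [b [x [bx [k yx]]]] : reachable g (set_val y) by exact: set_valP.
  exists (past_input b k) => //; apply: val_inj.
  apply: (USP_encoding_unique (hE _)); rewrite -set_valE yx.
  by have := orbit_encoding (solution_orbit k bx); rewrite subr0.
- move=> v u; apply: (@USP_encoding_unique (shift_in v u)); last exact: hE.
  exact/encoding_shift_in/hE.
Qed.

End UniqueSolution.

End Orbits.

Theorem lemma5 (R : realType) (U X : metricType R) (g : U * X -> X)
  (hg : compactly_driven_system g) :
  [/\ (exists h : left_seq U -> set_type (reachable g),
         universal_semiconjugacy h) <-> USP g,
      forall h : left_seq U -> set_type (reachable g),
        universal_semiconjugacy h ->
        eq_singleton_inv_comp (set_val \o h) (encoding g)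
    & forall h : left_seq U -> set_type (reachable g),
        set_surj [set: left_seq U] [set: set_type (reachable g)] h ->
        intertwines h ->
        ~ USP g -> ~ continuous h].
Proof.
have [[cX cg] _] := hg; split.
- split=> [[h [hc hs hi]]|]; last exact: USP_semiconjugacy.
  exact: semiconjugacy_USP hi hc hs.
- move=> h [hc hs hi]; apply/funext => u; apply/seteqP; split=> y /=.
    have [x ux] := USP_orbit (semiconjugacy_USP hi hc hs) u.
    rewrite /singleton_map /= (semiconjugacy_orbit hi hc hs ux) => ->.
    exact: orbit_encoding.
  move=> /(encoding_orbit cX cg)[x ux <-].
  by rewrite /singleton_map /= (semiconjugacy_orbit hi hc hs ux).
- by move=> h hs hi nusp hc; exact/nusp/(semiconjugacy_USP hi hc hs).
Qed.
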